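(* Let $A$ be a clustering of $\{1,\dots,n\}$ with $1<k_A<n$, let $s$ be a cluster-size specification of $n$ elements, and let $B\sim\mathcal C(s)$. Then $$\mathbf E[\mathrm{CD}(A,B)]-\tfrac12=-\frac1\pi\sum_{k=1}^\infty\frac{(2k)!}{2^{2k}(k!)^2}\,\frac{\mathbf E[\mathrm{CC}(A,B)^{2k+1}]}{2k+1}.$$
   Context: A clustering of $\{1,\dots,n\}$ is a partition $A=\{A_1,\dots,A_{k_A}\}$ into nonempty clusters. Let $N=\binom n2$. For a clustering $A$, let $\vec A\in\{0,1\}^N$ be indexed by unordered pairs of distinct elements, with entry $1$ iff the pair lies in one cluster of $A$; let $m_A$ be the number of such pairs and $\mathbf 1$ the all-ones vector. Define $\vec u(A)=\frac1{\sqrt N}\mathbf 1$ if $k_A=1$, $\vec u(A)=(\vec A-\frac{m_A}N\mathbf 1)/\|\vec A-\frac{m_A}N\mathbf 1\|$ if $1<k_A<n$, $\vec u(A)=-\frac1{\sqrt N}\mathbf 1$ if $k_A=n$. Then $\mathrm{CC}(A,B)=\langle\vec u(A),\vec u(B)\rangle$ (the Pearson correlation of $\vec A,\vec B$ when both clusterings are nontrivial) and $\mathrm{CD}(A,B)=\frac1\pi\arccos\mathrm{CC}(A,B)$. For a multiset $s$ of positive integers summing to $n$, $\mathcal C(s)$ is the uniform distribution over clusterings with cluster sizes $s$. *)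

(* Defs.v *)
From Stdlib Require Import Reals.
From mathcomp Require Import all_boot.

Set Implicit Arguments.
Unset Strict Implicit.
Unset Printing Implicit Defensive.

Local Open Scope R_scope.

(* A clustering of {0,...,n-1} (relabelling of {1,...,n}) is a set of blocks
   P : {set {set 'I_n}} with [partition P [set: 'I_n]] (nonempty, disjoint,
   covering blocks); k_P = #|P|. *)
Definition clustering (n : nat) (P : {set {set 'I_n}}) : bool :=
  partition P [set: 'I_n].

Definition pairs_sum (n : nat) (F : 'I_n -> 'I_n -> R) : R :=
  \big[Rplus/0]_(p : 'I_n * 'I_n | ltn p.1 p.2) F p.1 p.2.

Definition Npairs (n : nat) : R := INR 'C(n, 2).

Definition indic (n : nat) (P : {set {set 'I_n}}) (i j : 'I_n) : R :=
  if [exists B in P, (i \in B) && (j \in B)] then 1 else 0.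

Definition mA (n : nat) (P : {set {set 'I_n}}) : R := pairs_sum (indic P).

Definition centered (n : nat) (P : {set {set 'I_n}}) (i j : 'I_n) : R :=
  indic P i j - mA P / Npairs n.

Definition cnorm (n : nat) (P : {set {set 'I_n}}) : R :=
  sqrt (pairs_sum (fun i j => (centered P i j) ^ 2)).

Definition uvec (n : nat) (P : {set {set 'I_n}}) (i j : 'I_n) : R :=
  if #|P| == 1%N then / sqrt (Npairs n)
  else if #|P| == n then - / sqrt (Npairs n)
  else centered P i j / cnorm P.

Definition CC (n : nat) (A B : {set {set 'I_n}}) : R :=
  pairs_sum (fun i j => uvec A i j * uvec B i j).

Definition CD (n : nat) (A B : {set {set 'I_n}}) : R :=
  / PI * acos (CC A B).

(* cluster sizes of P as a sequence (a multiset up to perm_eq) *)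
Definition sizes (n : nat) (P : {set {set 'I_n}}) : seq nat :=
  map (fun B : {set 'I_n} => #|B|) (enum P).

Definition size_spec (n : nat) (s : seq nat) : Prop :=
  all (fun x => ltn 0%nat x) s /\ sumn s = n.

Definition clusterings_with (n : nat) (s : seq nat) : {set {set {set 'I_n}}} :=
  [set P : {set {set 'I_n}} | clustering P && perm_eq (sizes P) s].

Definition Expect_C (n : nat) (s : seq nat) (f : {set {set 'I_n}} -> R) : R :=
  (\big[Rplus/0]_(P in clusterings_with n s) f P) / INR #|clusterings_with n s|.

Definition acoef (k : nat) : R :=
  INR (Factorial.fact (2 * k)%nat) / (2 ^ (2 * k)%nat * (INR (Factorial.fact k)) ^ 2).

Arguments Expect_C : clear implicits.
Arguments clusterings_with : clear implicits.

(* Main.v *)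
(** For [-1 <= x <= 1], [acos x = PI / 2 - asin x], and the Taylor series of
    [asin] has coefficients [acoef k / (2 k + 1)].  It converges to [asin] on the
    whole closed interval: inside because [acoef] generates [1 / sqrt (1 - x)],
    at the endpoints by monotone convergence.  Taking expectations term by term
    (a finite average) gives the claimed expansion plus the term [k = 0], namely
    [E (CC A B)].  That term vanishes: relabelling the points preserves the
    distribution of [B] and acts transitively on pairs, so the average of
    [uvec B] is a constant vector, while the entries of [uvec A] sum to 0. *)
Require Import Defs.
From HB Require Import structures.
From Stdlib Require Import Reals Lra.
From mathcomp Require Import all_boot perm.
From Coquelicot Require Import Coquelicot.
Local Open Scope R_scope.

(** * Central binomial coefficients and the power series of [1 / sqrt (1 - x)] *)

Lemma acoef0 : acoef 0 = 1.
Proof. by rewrite /acoef muln0 /=; field. Qed.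

(** [acoef k] is $\binom{2k}{k}/4^k$, and consecutive values have ratio $(2k+1)/(2k+2)$. The form
    without division is what a differential equation gives coefficient by coefficient. *)
Lemma acoefS k : acoef k.+1 * (2 * INR k.+1) = acoef k * (2 * INR k + 1).
Proof.
have -> : acoef k.+1 = INR (Factorial.fact (2 * k)%N) * (2 * INR k + 1) *
    (2 * INR k + 2) / (2 ^ (2 * k)%N * 4 *
    (INR k.+1 * INR (Factorial.fact k)) ^ 2).
  rewrite /acoef mulnS !addSn add0n.
  rewrite -[Factorial.fact (2 * k).+2]/(((2 * k).+2 * ((2 * k).+1 *
    Factorial.fact (2 * k)))%coq_nat).
  rewrite -[Factorial.fact k.+1]/((k.+1 * Factorial.fact k)%coq_nat).
  rewrite !mult_INR !S_INR -multE mult_INR /=.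
  congr (_ / _); ring.
rewrite /acoef S_INR; field.
have := INR_fact_neq_0 k; have := pos_INR k; have : 2 ^ (2 * k)%N <> 0.
  by apply: pow_nonzero; lra.
by repeat split => //; lra.
Qed.

Lemma acoef_gt0 k : 0 < acoef k.
Proof.
apply: Rdiv_lt_0_compat; first exact: INR_fact_lt_0.
by apply: Rmult_lt_0_compat; apply: pow_lt; [lra | apply: INR_fact_lt_0].
Qed.

(** The ratio given by [acoefS] is below 1. This crude bound already yields a radius of convergence
    of at least 1. *)
Lemma acoef_le1 k : acoef k <= 1.
Proof.
elim: k => [|k IH]; first by rewrite acoef0; lra.
have := acoefS k; have := acoef_gt0 k; have := pos_INR k; rewrite S_INR.
by nra.
Qed.

Lemma CV_radius_ge1 (a : nat -> R) :
  (forall n, Rabs (a n) <= 1) -> Rbar_le 1 (CV_radius a).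
Proof.
move=> a1; apply: (proj1 (CV_radius_bounded a)).
by exists 1 => n; rewrite pow1 Rmult_1_r.
Qed.

Lemma Rabs_acoef_le1 k : Rabs (acoef k) <= 1.
Proof.
by rewrite Rabs_pos_eq; [apply: acoef_le1 | apply: Rlt_le; apply: acoef_gt0].
Qed.

Lemma Rabs_lt_CV_radius (a : nat -> R) x :
  (forall n, Rabs (a n) <= 1) -> Rabs x < 1 -> Rbar_lt (Rabs x) (CV_radius a).
Proof. by move=> a1 x1; apply: Rbar_lt_le_trans (CV_radius_ge1 a a1). Qed.

(** On coefficients, the factor [2 n + 1] is the operator $1 + 2x\,d/dx$. It serves twice: for the
    differential equation of [PSeries acoef], and for the derivative of $t\,h(t^2)$. *)
Lemma PSeries_index_mul (a : nat -> R) (x : R) :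
  Rbar_lt (Rabs x) (CV_radius a) ->
  PSeries (fun n => a n * (2 * INR n + 1)) x =
  PSeries a x + 2 * (x * PSeries (PS_derive a) x).
Proof.
move=> ax; have ad : ex_pseries (PS_derive a) x.
  by apply: CV_radius_inside; rewrite CV_radius_derive.
rewrite -PSeries_incr_1 -PSeries_scal -PSeries_plus.
- apply: PSeries_ext => -[|n]; rewrite /PS_plus /PS_scal /PS_incr_1.
    by rewrite /plus /scal /zero /= /mult /=; ring.
  by rewrite /plus /scal /= /mult /PS_derive -/(INR n.+1) /=; ring.
- exact: CV_radius_inside.
- apply: ex_pseries_scal; first by rewrite /mult /=; ring.
  exact: ex_pseries_incr_1.
Qed.

(* The recurrence [acoefS] is the differential equation [2 (1 - x) g' = g],
   which makes [g x * sqrt (1 - x)] constant. *)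
Lemma PSeries_acoef x : 0 <= x < 1 -> PSeries acoef x * sqrt (1 - x) = 1.
Proof.
move=> [x0 x1]; case: (Rle_lt_or_eq_dec _ _ x0) => [{}x0|<-]; last first.
  by rewrite Rminus_0_r sqrt_1 PSeries_0 acoef0; lra.
rewrite -(eq_is_derive (V := R_NormedModule)
  (fun t => PSeries acoef t * sqrt (1 - t)) 0 x _ x0).
  by rewrite Rminus_0_r sqrt_1 PSeries_0 acoef0; lra.
move=> t [t0 tx]; have t1 : Rabs t < 1 by rewrite Rabs_pos_eq //; lra.
have tr := Rabs_lt_CV_radius acoef t Rabs_acoef_le1 t1.
have ode : 2 * PSeries (PS_derive acoef) t =
    PSeries acoef t + 2 * (t * PSeries (PS_derive acoef) t).
  rewrite -PSeries_index_mul // -PSeries_scal; apply: PSeries_ext => n.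
  by rewrite -acoefS /PS_scal /PS_derive /scal /= /mult /=; ring.
have s0 : 0 < sqrt (1 - t) by apply: sqrt_lt_R0; lra.
have ss : sqrt (1 - t) * sqrt (1 - t) = 1 - t by apply: sqrt_sqrt; lra.
evar_last.
  apply: (is_derive_mult (K := R_AbsRing) (PSeries acoef) (fun t => sqrt (1 - t))).
  - exact: is_derive_PSeries.
  - by auto_derive; [lra | reflexivity].
  - by move=> *; rewrite /mult /=; ring.
rewrite /plus /mult /zero /=.
(* This factor clears the denominator in the derivative of the square root; what is left is
   [ode]. *)
apply: (Rmult_eq_reg_r (2 * sqrt (1 - t))); last by lra.
rewrite -/(Rminus 1 t).
set g' := PSeries (PS_derive _) _ in ode *.
transitivity (2 * g' * (sqrt (1 - t) * sqrt (1 - t)) - PSeries acoef t).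
  by field; lra.
by rewrite ss; lra.
Qed.

(** * The arcsine series on the closed interval *)

Definition asin_coef (k : nat) : R := acoef k / (2 * INR k + 1).

Lemma asin_coef_gt0 k : 0 < asin_coef k.
Proof.
apply: Rdiv_lt_0_compat; first exact: acoef_gt0.
by have := pos_INR k; lra.
Qed.

Lemma Rabs_asin_coef_le1 k : Rabs (asin_coef k) <= 1.
Proof.
rewrite Rabs_pos_eq; last by apply: Rlt_le; apply: asin_coef_gt0.
have k0 := pos_INR k; apply: Rle_trans (acoef_le1 k).
apply/Rle_div_l; first by lra.
by have := acoef_gt0 k; nra.
Qed.

(** Both sides vanish at 0 and have derivative [1 / sqrt (1 - t ^ 2)]: differentiating $t\,h(t^2)$
    multiplies the k-th coefficient of $h$ by $2k+1$, which turns [asin_coef] back into [acoef]. *)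
Lemma PSeries_asin_coef x :
  0 <= x < 1 -> x * PSeries asin_coef (x ^ 2) = asin x.
Proof.
move=> [x0 x1]; case: (Rle_lt_or_eq_dec _ _ x0) => [{}x0|<-]; last first.
  by rewrite asin_0; ring.
suff : 0 * PSeries asin_coef (0 ^ 2) - asin 0 =
       x * PSeries asin_coef (x ^ 2) - asin x by rewrite asin_0; lra.
apply: (eq_is_derive (V := R_NormedModule)
  (fun t => t * PSeries asin_coef (t ^ 2) - asin t) 0 x _ x0) => t [t0 tx].
have t2 : 0 <= t ^ 2 < 1 by split; nra.
have t1 : Rabs (t ^ 2) < 1 by rewrite Rabs_pos_eq //; lra.
have tr := Rabs_lt_CV_radius asin_coef (t ^ 2) Rabs_asin_coef_le1 t1.
have tI : -1 < t < 1 by lra.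
have gE := PSeries_acoef _ t2.
have s0 : 0 < sqrt (1 - t ^ 2) by apply: sqrt_lt_R0; lra.
have gE' : PSeries acoef (t ^ 2) =
    PSeries asin_coef (t ^ 2) +
    2 * (t ^ 2 * PSeries (PS_derive asin_coef) (t ^ 2)).
  rewrite -PSeries_index_mul //; apply: PSeries_ext => n.
  by rewrite /asin_coef; field; have := pos_INR n; lra.
evar_last.
  apply: (is_derive_minus (K := R_AbsRing) (V := R_NormedModule)
           (fun t => t * PSeries asin_coef (t ^ 2)) asin).
  - apply: (is_derive_mult (K := R_AbsRing) id
             (fun t => PSeries asin_coef (t ^ 2))).
    + exact: is_derive_id.
    + apply: (is_derive_comp (K := R_AbsRing) (V := R_NormedModule)
        (PSeries asin_coef) (fun t => t ^ 2)).
        exact: is_derive_PSeries.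
      by auto_derive; [done | reflexivity].
    + by move=> *; rewrite /mult /=; ring.
  - apply/is_derive_Reals; apply/(derive_pt_eq_1 asin t _ (derivable_pt_asin t tI)).
    exact: derive_pt_asin.
rewrite /minus /plus /opp /mult /scal /one /zero /= /mult /=.
have -> : 1 / sqrt (1 - Rsqr t) = PSeries acoef (t ^ 2).
  rewrite Rsqr_pow2; apply: (Rmult_eq_reg_r (sqrt (1 - t ^ 2))); last by lra.
  by rewrite gE; field; lra.
rewrite gE' /=; ring.
Qed.

Lemma pow_odd (x : R) (k : nat) : x ^ (2 * k + 1)%N = x * (x ^ 2) ^ k.
Proof. by rewrite -pow_mult multE addn1. Qed.

Lemma is_series_asin_lt1 x : 0 <= x < 1 ->
  is_series (fun k => asin_coef k * x ^ (2 * k + 1)%N) (asin x).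
Proof.
move=> x01; rewrite -PSeries_asin_coef //.
have x2 : Rabs (x ^ 2) < 1 by rewrite Rabs_pos_eq; nra.
have /is_pseries_R P : is_pseries asin_coef (x ^ 2) (PSeries asin_coef (x ^ 2)).
  apply: PSeries_correct; apply: CV_radius_inside.
  by apply: Rabs_lt_CV_radius => //; apply: Rabs_asin_coef_le1.
apply: is_series_ext (is_series_scal_l x _ _ P) => k.
by rewrite pow_odd /scal /= /mult /=; ring.
Qed.

Lemma sum_n_le_series (u : nat -> R) (l : R) N :
  (forall k, 0 <= u k) -> is_series u l -> sum_n u N <= l.
Proof.
move=> u0 ul; apply: (is_lim_seq_incr_compare (sum_n u) l ul) => n.
by rewrite sum_Sn /plus /=; have := u0 n.+1; lra.
Qed.

(** At a point $x<1$ the partial sums stay below [asin x], hence below [PI / 2]; then $x$ tends to 1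
    along [1 - / INR i.+1]. *)
Lemma sum_asin_coef_le N : sum_n asin_coef N <= PI / 2.
Proof.
have xlim : is_lim_seq (fun i => 1 - / INR i.+1) 1.
  rewrite -[X in is_lim_seq _ (Finite X)]Rminus_0_r.
  apply: is_lim_seq_minus'; first exact: is_lim_seq_const.
  apply/(is_lim_seq_incr_1 (fun i => / INR i)).
  exact: (is_lim_seq_inv INR p_infty is_lim_seq_INR).
have plim m : is_lim_seq (fun i => (1 - / INR i.+1) ^ m) 1.
  elim: m => [|m IH]; first exact: is_lim_seq_const.
  rewrite -[X in is_lim_seq _ (Finite X)](Rmult_1_l 1).
  exact: is_lim_seq_mult'.
(* On $[0,1)$ every power $x^{2k+1}$ with $k\le N$ is at least $x^{2N+1}$, so a single common
   factor, with one limit, replaces all the powers. *)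
have := is_lim_seq_scal_l _ (sum_n asin_coef N) _ (plim (2 * N + 1)%N).
rewrite [Rbar_mult _ _]/= Rmult_1_r => slim.
apply: (is_lim_seq_le _ _ _ _ _ slim (is_lim_seq_const (PI / 2))) => i.
set x := 1 - _.
have x01 : 0 <= x < 1.
  have i1 : 1 <= INR i.+1 by rewrite S_INR; have := pos_INR i; lra.
  have : 0 < / INR i.+1 by apply: Rinv_0_lt_compat; lra.
  have : / INR i.+1 <= 1 by rewrite -Rinv_1; apply: Rinv_le_contravar; lra.
  by rewrite /x; lra.
apply: Rle_trans (proj2 (asin_bound x)).
apply: Rle_trans (sum_n_le_series _ _ N _ (is_series_asin_lt1 x x01)); last first.
  move=> k; apply: Rmult_le_pos; first by apply: Rlt_le; apply: asin_coef_gt0.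
  by apply: pow_le; lra.
rewrite Rmult_comm !sum_n_Reals scal_sum; apply: sum_Rle => k kN.
apply: Rmult_le_compat_l; first by apply: Rlt_le; apply: asin_coef_gt0.
have -> : (2 * N + 1 = (2 * k + 1) + 2 * (N - k))%N.
  by rewrite addnAC -mulnDr subnKC //; apply/leP.
rewrite pow_add -[X in _ <= X]Rmult_1_r.
apply: Rmult_le_compat_l; first by apply: pow_le; lra.
by rewrite -(pow1 (2 * (N - k))%N); apply: pow_incr; lra.
Qed.

(** The partial sums increase to some [l] at most [PI / 2]. Termwise domination gives [asin z <= l]
    for every $z$ in $[0,1)$, and these arcsines come arbitrarily close to [PI / 2]. *)
Lemma is_series_asin_coef : is_series asin_coef (PI / 2).
Proof.
have inc n : sum_n asin_coef n <= sum_n asin_coef n.+1.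
  by rewrite sum_Sn /plus /=; have := asin_coef_gt0 n.+1; lra.
have [l ul] := ex_finite_lim_seq_incr _ _ inc sum_asin_coef_le.
suff -> : PI / 2 = l by [].
apply: Rle_antisym; last first.
  exact: (is_lim_seq_le _ _ _ _ sum_asin_coef_le ul (is_lim_seq_const _)).
apply: Rnot_lt_le => lpi.
have p0 := PI_RGT_0.
have l0 : 0 <= l.
  apply: Rle_trans (is_lim_seq_incr_compare _ _ ul inc 0).
  by rewrite sum_O; apply: Rlt_le; apply: asin_coef_gt0.
(* A point [y] of [(l, PI / 2)] is [asin (sin y)], and [sin y < 1]. *)
pose y := (l + PI / 2) / 2; have [y1 y2] : l < y < PI / 2 by rewrite /y; lra.
have s01 : 0 <= sin y < 1.
  split; first by apply: sin_ge_0; lra.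
  by rewrite -sin_PI2; apply: sin_increasing_1; lra.
have sy := is_series_asin_lt1 _ s01; rewrite asin_sin in sy; last by lra.
suff : y <= l by lra.
apply: (is_lim_seq_le _ (sum_n asin_coef) y l _ sy ul) => N.
rewrite !sum_n_Reals; apply: sum_Rle => k _; rewrite -[X in _ <= X]Rmult_1_r.
apply: Rmult_le_compat_l; first by apply: Rlt_le; apply: asin_coef_gt0.
by rewrite -(pow1 (2 * k + 1)%N); apply: pow_incr; lra.
Qed.

Lemma is_series_asin x : -1 <= x <= 1 ->
  is_series (fun k => asin_coef k * x ^ (2 * k + 1)%N) (asin x).
Proof.
have pos z : 0 <= z <= 1 ->
    is_series (fun k => asin_coef k * z ^ (2 * k + 1)%N) (asin z).
  move=> [z0 z1]; case: (Rle_lt_or_eq_dec _ _ z1) => [{}z1|->].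
    exact: is_series_asin_lt1.
  rewrite asin_1; apply: is_series_ext is_series_asin_coef => k.
  by rewrite pow1 Rmult_1_r.
move=> x1; case: (Rle_dec 0 x) => x0; first by apply: pos; lra.
(* For negative [x], [asin] and all the odd powers change sign. *)
rewrite -[x]Ropp_involutive asin_opp.
apply: is_series_ext (is_series_opp _ _ (pos (- x) _)); last by lra.
move=> k; rewrite /opp !pow_odd.
have -> : (- - x) ^ 2 = (- x) ^ 2 by ring.
by rewrite /=; ring.
Qed.

(** * Finite real sums and sums over pairs *)

Lemma RplusA : associative Rplus.
Proof. by move=> x y z; rewrite Rplus_assoc. Qed.

(** These structures make the generic big-operator lemmas (splitting, exchange, distributivity)
    apply to real sums. *)
HB.instance Definition _ :=
  Monoid.isComLaw.Build R 0 Rplus RplusA Rplus_comm Rplus_0_l.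
HB.instance Definition _ :=
  Monoid.isMulLaw.Build R 0 Rmult Rmult_0_l Rmult_0_r.
HB.instance Definition _ :=
  Monoid.isAddLaw.Build R Rmult Rplus Rmult_plus_distr_r Rmult_plus_distr_l.

Lemma Rsum_const (I : finType) (A : {pred I}) (c : R) :
  \big[Rplus/0]_(i in A) c = INR #|A| * c.
Proof.
rewrite big_const; elim: #|A| => [|k IH]; first by rewrite /=; ring.
by rewrite iterS IH S_INR; ring.
Qed.

Lemma Rsum_le (I : finType) (P : pred I) (F G : I -> R) :
  (forall i, P i -> F i <= G i) ->
  \big[Rplus/0]_(i | P i) F i <= \big[Rplus/0]_(i | P i) G i.
Proof.
move=> FG; apply: (big_ind2 Rle) => //; first exact: Rle_refl.
by move=> *; apply: Rplus_le_compat.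
Qed.

(** The larger element [j] has [j] smaller partners, and these counts add up to the binomial
    coefficient. *)
Lemma card_ordered_pairs n :
  #|[pred p : 'I_n * 'I_n | ltn p.1 p.2]| = 'C(n, 2).
Proof.
rewrite -sum1_card -bin2_sum big_mkord.
rewrite -(pair_big_dep xpredT (fun i j : 'I_n => ltn i j) (fun _ _ => 1%N)) /=.
rewrite (exchange_big_dep xpredT) //=; apply: eq_bigr => j _.
by rewrite -(big_ord_widen n (fun=> 1%N) (ltnW (ltn_ord j))) sum1_card card_ord.
Qed.

Lemma pairs_sum_const n (c : R) :
  pairs_sum (fun _ _ : 'I_n => c) = Npairs n * c.
Proof. by rewrite /Npairs -card_ordered_pairs -Rsum_const. Qed.

Lemma pairs_sumZ n (c : R) (F : 'I_n -> 'I_n -> R) :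
  pairs_sum (fun i j => c * F i j) = c * pairs_sum F.
Proof. by rewrite /pairs_sum big_distrr. Qed.

Lemma pairs_sumD n (F G : 'I_n -> 'I_n -> R) :
  pairs_sum (fun i j => F i j + G i j) = pairs_sum F + pairs_sum G.
Proof. by rewrite /pairs_sum big_split. Qed.

Lemma eq_pairs_sum n (F G : 'I_n -> 'I_n -> R) :
  (forall i j, i != j -> F i j = G i j) -> pairs_sum F = pairs_sum G.
Proof.
move=> FG; apply: eq_bigr => -[i j] /= ij; apply: FG.
by apply: contraTneq ij => ->; rewrite ltnn.
Qed.

Lemma pairs_sum_le n (F G : 'I_n -> 'I_n -> R) :
  (forall i j, F i j <= G i j) -> pairs_sum F <= pairs_sum G.
Proof. by move=> FG; apply: Rsum_le => p _. Qed.

Lemma pairs_sum_ge0 n (F : 'I_n -> 'I_n -> R) :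
  (forall i j, 0 <= F i j) -> 0 <= pairs_sum F.
Proof.
move=> F0; rewrite -(Rmult_0_r (Npairs n)) -pairs_sum_const.
exact: pairs_sum_le.
Qed.

Lemma Npairs_gt0 n : (1 < n)%N -> 0 < Npairs n.
Proof.
by move=> n1; rewrite -[0]/(INR 0); apply/lt_INR/ltP; rewrite bin_gt0.
Qed.

(** A permutation does not respect the order [i < j], but it respects [i != j]; doubling a symmetric
    sum passes from the first index set to the second. *)
Lemma pairs_sum_sym n (F : 'I_n -> 'I_n -> R) :
  (forall i j, F i j = F j i) ->
  2 * pairs_sum F =
  \big[Rplus/0]_(p : 'I_n * 'I_n | p.1 != p.2) F p.1 p.2.
Proof.
move=> Fs; rewrite (bigID (fun p : 'I_n * 'I_n => ltn p.1 p.2)) /=.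
have -> : 2 * pairs_sum F = pairs_sum F + pairs_sum F by ring.
congr (_ + _).
  apply: eq_bigl => -[i j] /=; case: ltngtP => ij; rewrite ?andbF // andbT.
  by apply/esym; apply: contraTneq ij => ->; rewrite ltnn.
pose sw (p : 'I_n * 'I_n) := (p.2, p.1).
have swK : involutive sw by case.
rewrite /pairs_sum (reindex_inj (inv_inj swK)) /=.
apply: eq_big => [[i j]|[i j] _] /=; last exact: Fs.
by rewrite -leqNgt ltn_neqAle eq_sym.
Qed.

Lemma pairs_sum_inj n (f : 'I_n -> 'I_n) (F : 'I_n -> 'I_n -> R) :
  injective f -> (forall i j, F i j = F j i) ->
  pairs_sum (fun i j => F (f i) (f j)) = pairs_sum F.
Proof.
move=> fI Fs; apply: (Rmult_eq_reg_l 2); last by lra.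
rewrite !pairs_sum_sym //.
pose ff (p : 'I_n * 'I_n) := (f p.1, f p.2).
have ffI : injective ff by move=> [i j] [k l] [/fI -> /fI ->].
rewrite [RHS](reindex_inj ffI) /=.
by apply: eq_bigl => p; rewrite (inj_eq fI).
Qed.

(** * Relabelling the points, and transitivity on pairs *)

Lemma indic_sym n (P : {set {set 'I_n}}) i j : indic P i j = indic P j i.
Proof.
by rewrite /indic (eq_existsb (fun B => congr1 (andb _) (andbC _ _))).
Qed.

Lemma centered_sym n (P : {set {set 'I_n}}) i j :
  centered P i j = centered P j i.
Proof. by rewrite /centered indic_sym. Qed.

Definition relabel {n} (f : 'I_n -> 'I_n) (P : {set {set 'I_n}}) :
  {set {set 'I_n}} := [set f @: (B : {set 'I_n}) | B in P].

Section Relabel.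
Variables (n : nat) (f : 'I_n -> 'I_n).
Hypothesis fI : injective f.

Lemma relabel_inj : injective (relabel f).
Proof. exact/imset_inj/imset_inj. Qed.

Lemma card_relabel P : #|relabel f P| = #|P|.
Proof. exact/card_imset/imset_inj. Qed.

Lemma relabel_setT : f @: [set: 'I_n] = [set: 'I_n].
Proof. by apply/eqP; rewrite eqEcard subsetT card_imset //=. Qed.

Lemma perm_sizes_relabel P : perm_eq (sizes (relabel f P)) (sizes P).
Proof.
have -> : sizes P = [seq #|B : {set 'I_n}| | B <- [seq f @: (B : {set 'I_n}) | B <- enum P]].
  by rewrite -map_comp; apply: eq_map => B /=; rewrite card_imset.
apply: perm_map; apply: uniq_perm; first exact: enum_uniq.
  by rewrite map_inj_uniq ?enum_uniq //; apply: imset_inj.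
move=> B; rewrite mem_enum; apply/imsetP/mapP => -[C CP ->]; exists C => //.
  by rewrite mem_enum.
by rewrite -mem_enum.
Qed.

(** With [relabel_inj], this makes relabelling a permutation of the support of the uniform
    distribution, so sums over it can be reindexed. *)
Lemma relabel_clusterings_with s P :
  (relabel f P \in clusterings_with n s) = (P \in clusterings_with n s).
Proof.
rewrite !inE; congr (_ && _); last exact: (permPl (perm_sizes_relabel P)).
by rewrite /clustering -{1}relabel_setT imset_partition.
Qed.

Lemma indic_relabel P i j : indic (relabel f P) (f i) (f j) = indic P i j.
Proof.
rewrite /indic; congr (if _ then _ else _); apply/existsP/existsP.
  move=> [_ /andP [/imsetP [B BP ->]]]; rewrite !mem_imset // => ij.
  by exists B; rewrite BP.
move=> [B /andP [BP ij]]; exists (f @: B); apply/andP; split.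
  exact: imset_f.
by rewrite !mem_imset.
Qed.

Lemma mA_relabel P : mA (relabel f P) = mA P.
Proof.
rewrite /mA -[LHS](pairs_sum_inj _ f) //; last exact: indic_sym.
by apply: eq_pairs_sum => i j _; rewrite indic_relabel.
Qed.

Lemma centered_relabel P i j :
  centered (relabel f P) (f i) (f j) = centered P i j.
Proof. by rewrite /centered mA_relabel indic_relabel. Qed.

Lemma cnorm_relabel P : cnorm (relabel f P) = cnorm P.
Proof.
rewrite /cnorm -[in LHS](pairs_sum_inj _ f) //; last first.
  by move=> i j; rewrite centered_sym.
by congr sqrt; apply: eq_pairs_sum => i j _; rewrite centered_relabel.
Qed.

Lemma uvec_relabel P i j : uvec (relabel f P) (f i) (f j) = uvec P i j.
Proof. by rewrite /uvec card_relabel centered_relabel cnorm_relabel. Qed.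

End Relabel.

Lemma pair_transitive n (i j k l : 'I_n) : i != j -> k != l ->
  exists f : 'I_n -> 'I_n, [/\ injective f, f i = k & f j = l].
Proof.
move=> ij kl; pose t := tperm i k.
exists (tperm (t j) l \o t); split=> /=.
- exact: inj_comp perm_inj perm_inj.
- have tik : t i = k by rewrite tpermL.
  by rewrite tik tpermD //; [rewrite -tik (inj_eq perm_inj) eq_sym | rewrite eq_sym].
- exact: tpermL.
Qed.

Lemma sum_uvec_const n s (i j k l : 'I_n) : i != j -> k != l ->
  \big[Rplus/0]_(B in clusterings_with n s) uvec B i j =
  \big[Rplus/0]_(B in clusterings_with n s) uvec B k l.
Proof.
move=> ij kl; have [f [fI <- <-]] := pair_transitive _ _ _ _ _ ij kl.
rewrite [RHS](reindex_inj (relabel_inj _ _ fI)).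
apply: eq_big => [B|B _]; first by rewrite relabel_clusterings_with.
by rewrite uvec_relabel.
Qed.

(** * Zero mean of [uvec], bounds on [CC], and vanishing of its average *)

Lemma pairs_sum_uvec n (A : {set {set 'I_n}}) :
  (1 < #|A| < n)%N -> pairs_sum (uvec A) = 0.
Proof.
move=> /andP [A1 An].
have N0 := Npairs_gt0 _ (ltn_trans A1 An).
have -> : pairs_sum (uvec A) =
    pairs_sum (fun i j => / cnorm A * (indic A i j + - (mA A / Npairs n))).
  apply: eq_pairs_sum => i j _; rewrite /uvec.
  by rewrite (gtn_eqF A1) (ltn_eqF An) /centered /Rdiv /Rminus Rmult_comm.
rewrite pairs_sumZ pairs_sumD pairs_sum_const -/(mA A).
have -> : mA A + Npairs n * - (mA A / Npairs n) = 0 by field; lra.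
by rewrite Rmult_0_r.
Qed.

(** The inequality is all that Cauchy-Schwarz requires, and it also covers a zero [cnorm]. *)
Lemma pairs_sum_uvec_sqr_le n (A : {set {set 'I_n}}) :
  (1 < n)%N -> pairs_sum (fun i j => uvec A i j ^ 2) <= 1.
Proof.
move=> n1; have N0 := Npairs_gt0 _ n1.
have s0 := sqrt_lt_R0 _ N0; have ss := sqrt_sqrt _ (Rlt_le _ _ N0).
have NN : Npairs n * (/ sqrt (Npairs n)) ^ 2 <= 1.
  by rewrite -{1}ss; right; field; lra.
rewrite /uvec; case: eqP => _; first by rewrite pairs_sum_const.
case: eqP => _.
  by rewrite pairs_sum_const; apply: Rle_trans NN; right; ring.
have -> : pairs_sum (fun i j => (centered A i j / cnorm A) ^ 2) =
    (/ cnorm A) ^ 2 * pairs_sum (fun i j => centered A i j ^ 2).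
  rewrite -pairs_sumZ; apply: eq_pairs_sum => i j _.
  by rewrite /Rdiv Rpow_mult_distr Rmult_comm.
set S := pairs_sum _.
have S0 : 0 <= S by apply: pairs_sum_ge0 => i j; apply: pow2_ge_0.
have cS : cnorm A * cnorm A = S by apply: sqrt_sqrt.
(* If the norm is 0, then [S] is 0 and so is the product, whatever the value of [/ 0]. *)
case: (Req_dec (cnorm A) 0) => c0; last by rewrite -cS; right; field.
by rewrite -cS c0; lra.
Qed.

(** Cauchy-Schwarz for vectors of norm at most 1: expand $(c\,u-v)^2\ge 0$ with $c=\pm1$ and sum
    over the pairs. *)
Lemma CC_bound n (A B : {set {set 'I_n}}) : (1 < n)%N -> -1 <= CC A B <= 1.
Proof.
move=> n1.
have a1 := pairs_sum_uvec_sqr_le _ A n1; have b1 := pairs_sum_uvec_sqr_le _ B n1.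
have amgm c : c ^ 2 = 1 -> c * CC A B <= 1.
  move=> c1; suff : 2 * c * CC A B <= 1 + 1 by lra.
  apply: Rle_trans (Rplus_le_compat _ _ _ _ a1 b1).
  rewrite /CC -pairs_sumZ -pairs_sumD; apply: pairs_sum_le => i j.
  have : 0 <= (c * uvec A i j - uvec B i j) ^ 2 by apply: pow2_ge_0.
  have -> : (c * uvec A i j - uvec B i j) ^ 2 = c ^ 2 * uvec A i j ^ 2 +
    uvec B i j ^ 2 - 2 * c * (uvec A i j * uvec B i j) by ring.
  by rewrite c1; lra.
have := amgm 1; have := amgm (-1); lra.
Qed.

Lemma sum_CC n s (A : {set {set 'I_n}}) : (1 < #|A| < n)%N ->
  \big[Rplus/0]_(B in clusterings_with n s) CC A B = 0.
Proof.
move=> An; have n1 : (1 < n)%N by case/andP: An; apply: ltn_trans.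
(* The pair of points 0 and 1 is a reference: by [sum_uvec_const], its sum [c] is the sum at every
   pair. *)
pose i0 := Ordinal (ltnW n1); pose i1 := Ordinal n1.
pose c := \big[Rplus/0]_(B in clusterings_with n s) uvec B i0 i1.
rewrite /CC /pairs_sum exchange_big /=.
transitivity (pairs_sum (fun i j => c * uvec A i j)).
  transitivity (pairs_sum (fun i j => uvec A i j *
      \big[Rplus/0]_(B in clusterings_with n s) uvec B i j)).
    by apply: eq_bigr => p _; rewrite big_distrr.
  apply: eq_pairs_sum => i j ij; rewrite Rmult_comm.
  by rewrite (sum_uvec_const _ s i j i0 i1 ij).
by rewrite pairs_sumZ pairs_sum_uvec // Rmult_0_r.
Qed.

(** * Existence of a clustering with prescribed sizes *)

(** Blocks are cut off one at a time, so [D] must vary in the induction. Positive sizes keep the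
    blocks nonempty. The result makes the denominator of [Expect_C] nonzero. *)
Lemma partition_of_sizes (T : finType) (D : {set T}) (s : seq nat) :
  all (fun x => ltn 0%nat x) s -> sumn s = #|D| ->
  exists P : {set {set T}},
    partition P D /\ perm_eq [seq #|B : {set T}| | B <- enum P] s.
Proof.
elim: s D => [|x s IH] D /=.
  move=> _ /esym/eqP; rewrite cards_eq0 => /eqP ->.
  by exists set0; rewrite partition_set0 eqxx enum_set0.
move=> /andP [x0 s0] sD.
pose C := [set y in take x (enum D)].
have CD : C \subset D.
  by apply/subsetP => y; rewrite inE => /mem_take; rewrite mem_enum.
have Cx : #|C| = x.
  rewrite cardsE (card_uniqP _); last by rewrite take_uniq ?enum_uniq.
  by rewrite size_take_min -cardE -sD; apply/minn_idPl/leq_addr.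
have [P [PD Ps]] : exists P : {set {set T}}, partition P (D :\: C) /\
    perm_eq [seq #|B : {set T}| | B <- enum P] s.
  by apply: IH => //; rewrite cardsDS // Cx -sD addKn.
have C0 : C != set0 by rewrite -cards_eq0 Cx -lt0n.
have dis : [disjoint C & D :\: C].
  by rewrite -setI_eq0 setIC setIDAC -setIDA setDv setI0.
have CP : C \notin P.
  have /set0Pn [y yC] := C0.
  by apply/negP => /(partitionS PD)/subsetP/(_ y yC); rewrite in_setD yC.
exists (C |: P); split.
  by rewrite -(setID D C) (setIidPr CD); apply: partitionU1.
have -> : x :: s = #|C| :: s by rewrite Cx.
apply: (@perm_trans _ [seq #|B : {set T}| | B <- C :: enum P]); last by rewrite /= perm_cons.
apply: perm_map; apply: uniq_perm; first exact: enum_uniq.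
  by rewrite /= mem_enum CP enum_uniq.
by move=> B; rewrite inE !mem_enum !inE.
Qed.

Lemma card_clusterings_with_gt0 n s :
  size_spec n s -> (0 < #|clusterings_with n s|)%N.
Proof.
move=> [s0 sn]; have sT : sumn s = #|[set: 'I_n]| by rewrite cardsT card_ord.
have [P [PT Ps]] := partition_of_sizes _ _ _ s0 sT.
by apply/card_gt0P; exists P; rewrite inE; apply/andP.
Qed.

(** * Termwise expectation and the final expansion *)

Lemma is_series_Rsum (I : finType) (P : pred I) (u : I -> nat -> R) (l : I -> R) :
  (forall i, P i -> is_series (u i) (l i)) ->
  is_series (fun k => \big[Rplus/0]_(i | P i) u i k)
            (\big[Rplus/0]_(i | P i) l i).
Proof.
move=> ul; elim: (index_enum I) => [|i r IH].
  rewrite big_nil; apply: (is_series_ext (fun=> 0)) => [k|].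
    by rewrite big_nil.
  suff : is_lim_seq (sum_n (fun=> 0)) 0 by [].
  apply: (is_lim_seq_ext (fun=> 0)); last exact: is_lim_seq_const.
  by move=> k; rewrite sum_n_const Rmult_0_r.
rewrite big_cons; case: ifP => Pi.
  apply: is_series_ext (is_series_plus _ _ _ _ (ul i Pi) IH) => k.
  by rewrite big_cons Pi.
by apply: is_series_ext IH => k; rewrite big_cons Pi.
Qed.

Lemma INR_odd k : INR (2 * k + 1)%N = 2 * INR k + 1.
Proof. by rewrite -plusE -multE plus_INR mult_INR. Qed.

(** This is the series of [asin x] without its first term [x], with the index shifted by one to
    match a sum that starts at 1. *)
Lemma is_series_acos x : -1 <= x <= 1 ->
  is_series (fun k => acoef (k + 1) * x ^ (2 * (k + 1) + 1)%N /
                      INR (2 * (k + 1) + 1)%N)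
            (PI / 2 - acos x - x).
Proof.
move=> x1; rewrite acos_asin //.
have -> : PI / 2 - (PI / 2 - asin x) - x = asin x - x by ring.
apply: (is_series_ext (fun k => asin_coef k.+1 * x ^ (2 * k.+1 + 1)%N)).
  move=> k; rewrite [(k + 1)%N]addn1 INR_odd /asin_coef.
  move: (acoef _) (x ^ _) (2 * INR _ + 1) => a p d.
  suff : a / d * p = a * p / d by [].
  by rewrite /Rdiv !Rmult_assoc (Rmult_comm p).
have H := is_series_incr_1 (V := R_NormedModule)
  (fun k => asin_coef k * x ^ (2 * k + 1)%N) (asin x - x).
apply: H.
suff -> : plus (asin x - x) (asin_coef 0 * x ^ (2 * 0 + 1)%N) = asin x.
  exact: is_series_asin.
by rewrite /plus muln0 /asin_coef acoef0 /=; field.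
Qed.

Theorem mainTheorem7 (n : nat) (A : {set {set 'I_n}}) (s : seq nat) :
  clustering A -> ltn 1%nat #|A| && ltn #|A| n -> size_spec n s ->
  exists l : R,
    infinite_sum
      (fun k : nat =>
         acoef (k + 1)%nat *
         Expect_C n s (fun B => CC A B ^ (2 * (k + 1) + 1)%nat) /
         INR (2 * (k + 1) + 1)%nat) l /\
    Expect_C n s (fun B => CD A B) - 1 / 2 = - (1 / PI) * l.
Proof.
move=> _ An sn.
have n1 : (1 < n)%N by case/andP: An; apply: ltn_trans.
set K := clusterings_with n s.
have K0 : INR #|K| <> 0.
  by apply: not_0_INR => /eqP; apply/negP; rewrite -lt0n card_clusterings_with_gt0.
(* [T] sums the limits given by [is_series_acos]. The subtracted [CC A B] is the term of index 0,
   whose total over [K] is zero by [sum_CC]. *)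
pose T := \big[Rplus/0]_(B in K) (PI / 2 - acos (CC A B) - CC A B).
exists (/ INR #|K| * T); split.
  apply/is_series_Reals.
  have S : is_series (fun k => \big[Rplus/0]_(B in K)
      (acoef (k + 1) * CC A B ^ (2 * (k + 1) + 1)%N / INR (2 * (k + 1) + 1)%N)) T.
    by apply: is_series_Rsum => B _; apply: is_series_acos; apply: CC_bound.
  apply: is_series_ext (is_series_scal_l (/ INR #|K|) _ _ S) => k.
  rewrite /Expect_C -/K.
  have -> : \big[Rplus/0]_(B in K)
      (acoef (k + 1) * CC A B ^ (2 * (k + 1) + 1)%N / INR (2 * (k + 1) + 1)%N) =
    acoef (k + 1) * (\big[Rplus/0]_(B in K) CC A B ^ (2 * (k + 1) + 1)%N) *
      / INR (2 * (k + 1) + 1)%N.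
    by rewrite big_distrr big_distrl.
  move: (acoef _) (\big[_/_]_(_ in _) _) (INR (_ + _)%N) => a m d.
  suff : / INR #|K| * (a * m * / d) = a * (m / INR #|K|) / d by [].
  by rewrite /Rdiv; ring.
pose Sa := \big[Rplus/0]_(B in K) acos (CC A B).
have -> : Expect_C n s (fun B => CD A B) = / INR #|K| * (/ PI * Sa).
  by rewrite /Expect_C -/K /Sa big_distrr /= /Rdiv Rmult_comm.
have -> : T = INR #|K| * (PI / 2) - Sa.
  have : T + \big[Rplus/0]_(B in K) CC A B + Sa = INR #|K| * (PI / 2).
    rewrite -Rsum_const /T /Sa -!big_split /=.
    by apply: eq_bigr => B _; ring.
  by rewrite (sum_CC _ s A An); move: T Sa => t a; lra.
move: (INR #|K|) Sa K0 => c a c0.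
by field; split=> //; apply: PI_neq0.
Qed.
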